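(* (Constructively, i.e. without using the Law of Excluded Middle.) The statement ''For any finite, noncollinear set of points $\mathscr{S}$ on the real plane $\mathbb{R}^{2}$, there exists a line that passes through exactly two points of $\mathscr{S}$'' implies the lesser limited principle of omniscience (LLPO), namely: for any real number $\alpha$, either $\alpha \le 0$ or $\alpha \ge 0$. (Thus the statement is constructively invalid.)
   Context: The setting is Bishop-style constructive mathematics: intuitionistic logic, with the Law of Excluded Middle not available; the implication is to be proved constructively. Real numbers are constructed by Cauchy sequences. For a real number $\alpha$, $\alpha\neq 0$ is the affirmative condition that one can construct a positive integer $n$ with $1/n<|\alpha|$ (and $\alpha\neq\beta$ means $\alpha-\beta\neq 0$). Valid constructive facts: if $\neg(\alpha\neq 0)$ then $\alpha=0$; if $\neg(\alpha>0)$ then $\alpha\le 0$; if $\neg(\alpha<0)$ then $\alpha\ge 0$; if $\alpha<\beta$ then for any real $x$ either $x>\alpha$ or $x<\beta$; if $\alpha\neq\beta$ then for any real $x$ either $x\neq\alpha$ or $x\neq\beta$ (cotransitivity). Points $A,B\in\mathbb{R}^2$ are distinct, written $A\neq B$, if the distance between them is positive. A point $P$ lies on a line $l$, written $P\in l$, if the distance $\rho(P,l)$ from $P$ to $l$ is $0$; $P$ lies outside $l$, written $P\notin l$, if $\rho(P,l)>0$. For distinct points $Q,R$, $QR$ denotes the line through them. A set is finite if its elements may be listed, $\{a_1,\dots,a_n\}$ with $n\ge 1$, but not necessarily distinctly. A set of points is noncollinear if it contains distinct points $P,Q,R$ such that $P$ lies outside the line $QR$. A line passes through exactly two points of $\mathscr{S}$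 if it is the line joining two distinct points of $\mathscr{S}$ and it is impossible for it to contain three pairwise distinct points of $\mathscr{S}$. LLPO is equivalently stated as: for any binary sequence $\{a_n\}$, either the first integer $n$ such that $a_n=1$ (if one exists) is even, or it is odd. A statement is considered constructively invalid if it implies an omniscience principle such as LLPO. *)

(* Defs.v *)
(* The real numbers are the Cauchy reals [CReal] of the standard library:
   [x < y] carries a witness and lives in [Set], [x <= y] is
   [y < x -> False] and [==] is antisymmetry of [<=]. Statements are read
   constructively, with [{x & P x}], [*] and [+] in [Type] for "one can
   construct", "and" and "or". *)

From Stdlib Require Import ConstructiveCauchyReals ConstructiveCauchyRealsMult
  ConstructiveCauchyAbs.
From Stdlib Require Import ZArith QArith Qabs Qpower Qround Lia Lqa.

Local Open Scope Q_scope.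

(* [Qsqrt_approx q k] is the largest multiple of [2 ^ k] whose square is at
   most [q], or [0] if [q < 0]. *)
Definition Qsqrt_approx (q : Q) (k : Z) : Q :=
  inject_Z (Z.sqrt (Qfloor (q / (2 ^ k * 2 ^ k)))) * 2 ^ k.

Lemma Qsqrt_approx_nonneg (q : Q) (k : Z) : 0 <= Qsqrt_approx q k.
Proof.
  unfold Qsqrt_approx. apply Qmult_le_0_compat.
  - change 0 with (inject_Z 0). rewrite <- Zle_Qle. apply Z.sqrt_nonneg.
  - apply Qlt_le_weak, Qpower_0_lt. reflexivity.
Qed.

Lemma Qsqrt_approx_upper (q : Q) (k : Z) :
  q < (Qsqrt_approx q k + 2 ^ k) * (Qsqrt_approx q k + 2 ^ k).
Proof.
  pose proof (Qsqrt_approx_nonneg q k) as Hn.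
  assert (Hk : 0 < 2 ^ k) by (apply Qpower_0_lt; reflexivity).
  destruct (Qlt_le_dec q 0) as [Hq|Hq]; [nra|].
  unfold Qsqrt_approx in *.
  set (e := 2 ^ k) in *. set (y := q / (e * e)).
  assert (Hy : q == y * (e * e)) by (unfold y; field; lra).
  assert (Hy0 : 0 <= y) by (apply Qle_shift_div_l; nra).
  assert (Hf : (0 <= Qfloor y)%Z) by
    (rewrite <- (Qfloor_Z 0); apply Qfloor_resp_le; exact Hy0).
  destruct (Z.sqrt_spec _ Hf) as [_ H2].
  pose proof (Qlt_floor y) as H3.
  set (s := Z.sqrt (Qfloor y)) in *.
  assert (H4 : (Qfloor y + 1 <= (s + 1) * (s + 1))%Z) by lia.
  rewrite Zle_Qle, inject_Z_mult, inject_Z_plus in H4.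
  change (inject_Z 1) with 1 in H4.
  rewrite inject_Z_plus in H3. change (inject_Z 1) with 1 in H3.
  rewrite inject_Z_plus in H4. change (inject_Z 1) with 1 in H4.
  rewrite Hy.
  setoid_replace ((inject_Z s * e + e) * (inject_Z s * e + e))
    with ((inject_Z s + 1) * (inject_Z s + 1) * (e * e)) by ring.
  apply Qmult_lt_compat_r; [nra|lra].
Qed.

Lemma Qsqrt_approx_lower (q b : Q) (k : Z) :
  q <= b -> 0 <= b -> Qsqrt_approx q k * Qsqrt_approx q k <= b.
Proof.
  intros Hqb Hb.
  assert (Hk : 0 < 2 ^ k) by (apply Qpower_0_lt; reflexivity).
  unfold Qsqrt_approx.
  set (e := 2 ^ k) in *. set (y := q / (e * e)).
  assert (Hy : q == y * (e * e)) by (unfold y; field; lra).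
  set (s := Z.sqrt (Qfloor y)).
  destruct (Z_lt_le_dec (Qfloor y) 0) as [Hf|Hf].
  - unfold s. rewrite Z.sqrt_neg by exact Hf. change (inject_Z 0) with 0. nra.
  - destruct (Z.sqrt_spec _ Hf) as [H1 _]. fold s in H1.
    pose proof (Qfloor_le y) as H3.
    rewrite Zle_Qle, inject_Z_mult in H1.
    apply (Qle_trans _ q); [|exact Hqb]. rewrite Hy.
    setoid_replace (inject_Z s * e * (inject_Z s * e))
      with (inject_Z s * inject_Z s * (e * e)) by ring.
    apply Qmult_le_compat_r; [lra|nra].
Qed.

Lemma Qpower2_split (n : Z) : 2 ^ n == 2 ^ (n - 1) + 2 ^ (n - 1).
Proof.
  replace n with (n - 1 + 1)%Z at 1 by lia.
  rewrite Qpower_plus by (intro H; discriminate H).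
  change (2 ^ 1) with 2. ring.
Qed.

Lemma Qpower2_double (n : Z) : 2 ^ (2 * n) == 2 ^ n * 2 ^ n.
Proof.
  replace (2 * n)%Z with (n + n)%Z by lia.
  apply Qpower_plus. intro H; discriminate H.
Qed.

Definition CReal_sqrt_seq (x : CReal) (n : Z) : Q :=
  Qsqrt_approx (seq x (2 * (n - 1))%Z) (n - 1).

Definition CReal_sqrt_scale (x : CReal) : Z := (Z.max (scale x) 0 + 1)%Z.

Lemma CReal_sqrt_cauchy (x : CReal) : QCauchySeq (CReal_sqrt_seq x).
Proof.
  assert (H : forall k p q, (p <= k)%Z -> (q <= k)%Z ->
            CReal_sqrt_seq x p < CReal_sqrt_seq x q + 2 ^ k).
  { intros k p q Hp Hq. unfold CReal_sqrt_seq.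
    pose proof (cauchy x (2 * (k - 1))%Z (2 * (p - 1))%Z (2 * (q - 1))%Z
                  ltac:(lia) ltac:(lia)) as C.
    set (a := seq x (2 * (p - 1))%Z) in *. set (b := seq x (2 * (q - 1))%Z) in *.
    rewrite Qpower2_double in C. apply Qabs_Qlt_condition in C.
    rewrite (Qpower2_split k).
    pose proof (Qsqrt_approx_nonneg a (p - 1)) as Hrp.
    pose proof (Qsqrt_approx_nonneg b (q - 1)) as Hrq.
    pose proof (Qsqrt_approx_upper b (q - 1)) as Hub.
    assert (Hd : 0 < 2 ^ (k - 1)) by (apply Qpower_0_lt; reflexivity).
    assert (Hqd : 2 ^ (q - 1) <= 2 ^ (k - 1))
      by (apply Qpower_le_compat_l; [lia|lra]).
    assert (Hq0 : 0 < 2 ^ (q - 1)) by (apply Qpower_0_lt; reflexivity).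
    set (rp := Qsqrt_approx a (p - 1)) in *.
    set (rq := Qsqrt_approx b (q - 1)) in *.
    set (d := 2 ^ (k - 1)) in *. set (e := 2 ^ (q - 1)) in *.
    assert (Hlo : rp * rp <= (rq + e) * (rq + e) + d * d).
    { apply Qsqrt_approx_lower; nra. }
    destruct (Qlt_le_dec rp (rq + (d + d))) as [|Hge]; [assumption|].
    exfalso. nra. }
  intros k p q Hp Hq. apply Qabs_Qlt_condition.
  pose proof (H k p q Hp Hq). pose proof (H k q p Hq Hp). split; lra.
Qed.

Lemma CReal_sqrt_bound (x : CReal) :
  QBound (CReal_sqrt_seq x) (CReal_sqrt_scale x).
Proof.
  intro k. unfold CReal_sqrt_scale, CReal_sqrt_seq.
  pose proof (bound x (2 * (k - 1))%Z) as B.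
  set (a := seq x (2 * (k - 1))%Z) in *.
  pose proof (Qsqrt_approx_nonneg a (k - 1)) as Hr.
  rewrite Qabs_pos by exact Hr.
  set (m := Z.max (scale x) 0).
  assert (Hs : 2 ^ scale x <= 2 ^ m)
    by (apply Qpower_le_compat_l; [lia|lra]).
  assert (Hm : 1 <= 2 ^ m)
    by (change 1 with (2 ^ 0); apply Qpower_le_compat_l; [lia|lra]).
  rewrite (Qpower2_split (m + 1)). replace (m + 1 - 1)%Z with m by lia.
  apply Qabs_Qlt_condition in B.
  assert (Hlo : Qsqrt_approx a (k - 1) * Qsqrt_approx a (k - 1) <= 2 ^ m)
    by (apply Qsqrt_approx_lower; lra).
  destruct (Qlt_le_dec (Qsqrt_approx a (k - 1)) (2 ^ m + 2 ^ m));
    [assumption|exfalso; nra].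
Qed.

Definition CReal_sqrt (x : CReal) : CReal := {|
  seq := CReal_sqrt_seq x;
  scale := CReal_sqrt_scale x;
  cauchy := CReal_sqrt_cauchy x;
  bound := CReal_sqrt_bound x |}.

Local Open Scope CReal_scope.

Lemma CReal_sqrt_nonneg (x : CReal) : 0 <= CReal_sqrt x.
Proof.
  intros [n Hn]. cbn in Hn. unfold CReal_sqrt_seq in Hn.
  pose proof (Qsqrt_approx_nonneg (seq x (2 * (n - 1))%Z) (n - 1)).
  assert (0 < 2 ^ n)%Q by (apply Qpower_0_lt; reflexivity).
  lra.
Qed.

Lemma CReal_sqrt_sqr (x : CReal) :
  0 <= x -> CReal_sqrt x * CReal_sqrt x == x.
Proof.
  intro Hx.
  assert (H : forall n, (n <= 0)%Z ->
    (seq (CReal_sqrt x * CReal_sqrt x) n <= seq x n + 2 * 2 ^ n)%Q /\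
    (seq x n <= seq (CReal_sqrt x * CReal_sqrt x) n + 2 * 2 ^ n)%Q).
  { intros n Hn. cbn [seq CReal_mult]. unfold CReal_mult_seq.
    cbn [seq scale CReal_sqrt].
    set (S := CReal_sqrt_scale x). set (m := (n - S - 1)%Z).
    assert (HS : (1 <= S)%Z) by (unfold S, CReal_sqrt_scale; lia).
    pose proof (CReal_sqrt_bound x m) as B. fold S in B.
    unfold CReal_sqrt_seq in *.
    set (a := seq x (2 * (m - 1))%Z) in *.
    pose proof (Qsqrt_approx_nonneg a (m - 1)) as Hr.
    rewrite Qabs_pos in B by exact Hr.
    pose proof (Qsqrt_approx_upper a (m - 1)) as Hu.
    pose proof (proj2 (CRealLe_not_lt 0 x) Hx (2 * (m - 1))%Z) as Hp.
    fold a in Hp. cbn [seq inject_Q] in Hp.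
    pose proof (cauchy x n n (2 * (m - 1))%Z ltac:(lia) ltac:(lia)) as C.
    fold a in C. apply Qabs_Qlt_condition in C.
    rewrite Qpower2_double in Hp.
    assert (Hd : (2 ^ (m - 1) * 2 ^ (m - 1) <= 2 ^ (n - 2))%Q).
    { rewrite <- Qpower2_double. apply Qpower_le_compat_l; [lia|lra]. }
    assert (He : (2 ^ S * 2 ^ (m - 1) == 2 ^ (n - 2))%Q).
    { rewrite <- Qpower_plus by (intro E; discriminate E).
      replace (S + (m - 1))%Z with (n - 2)%Z by lia. reflexivity. }
    assert (Hm : (0 < 2 ^ (m - 1))%Q) by (apply Qpower_0_lt; reflexivity).
    pose proof (Qpower2_split n) as Hn1.
    pose proof (Qpower2_split (n - 1)) as Hn2.
    replace (n - 1 - 1)%Z with (n - 2)%Z in Hn2 by lia.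
    set (r := Qsqrt_approx a (m - 1)) in *.
    set (d := (2 ^ (m - 1))%Q) in *.
    split.
    - assert (Hlo : (r * r <= a + 2 * (d * d))%Q)
        by (apply Qsqrt_approx_lower; nra).
      lra.
    - assert (Hrd : (r * d <= 2 ^ (n - 2))%Q)
        by (rewrite <- He; apply Qmult_le_compat_r; lra).
      nra. }
  split; intro L; apply CRealLt_above in L; destruct L as [k Hk];
    specialize (Hk (Z.min k 0) ltac:(lia));
    destruct (H (Z.min k 0) ltac:(lia)) as [H1 H2];
    assert (2 ^ Z.min k 0 <= 2 ^ k)%Q
      by (apply Qpower_le_compat_l; [lia|lra]); lra.
Qed.

Record point : Set := mkPoint { px : CReal; py : CReal }.

Definition point_eq (P Q : point) : Prop := px P == px Q /\ py P == py Q.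

Definition dist (P Q : point) : CReal :=
  CReal_sqrt ((px P - px Q) * (px P - px Q) + (py P - py Q) * (py P - py Q)).

Definition distinct (P Q : point) : Set := 0 < dist P Q.

(* The line [QR] through two distinct points. *)
Record line : Set := mkLine {
  lQ : point;
  lR : point;
  lQR : distinct lQ lR }.

(* The length of the component of [P - Q] normal to [R - Q]. It is the
   minimum distance from [P] to the points [Q + t (R - Q)], see
   [line_dist_le] and [line_dist_attained]. *)
Definition line_dist (P : point) (l : line) : CReal :=
  CReal_abs ((px (lR l) - px (lQ l)) * (py P - py (lQ l))
             - (py (lR l) - py (lQ l)) * (px P - px (lQ l)))
  * CReal_inv (dist (lQ l) (lR l)) (inr (lQR l)).

Definition line_point (l : line) (t : CReal) : point :=
  mkPoint (px (lQ l) + t * (px (lR l) - px (lQ l)))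
          (py (lQ l) + t * (py (lR l) - py (lQ l))).

Definition lies_on (P : point) (l : line) : Prop := line_dist P l == 0.

Definition lies_outside (P : point) (l : line) : Set := 0 < line_dist P l.

Definition same_line (l m : line) : Prop :=
  forall X : point, lies_on X l <-> lies_on X m.

Definition point_set : Type := point -> Type.

(* Only the values [a i] with [i < n] matter; repetitions are allowed. *)
Definition finite (S : point_set) : Type :=
  { n : nat & { a : nat -> point &
    ((1 <= n)%nat *
     forall P : point,
       (S P -> { i : nat & ((i < n)%nat * point_eq P (a i))%type }) *
       ({ i : nat & ((i < n)%nat * point_eq P (a i))%type } -> S P))%type } }.

Definition noncollinear (S : point_set) : Type :=
  { P : point & { Q : point & { R : point & { QR : distinct Q R &
    (S P * S Q * S R * distinct P Q * distinct P R *
     lies_outside P (mkLine Q R QR))%type } } } }.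

Definition contains_three (l : line) (S : point_set) : Type :=
  { A : point & { B : point & { C : point &
    (S A * S B * S C * lies_on A l * lies_on B l * lies_on C l *
     distinct A B * distinct A C * distinct B C)%type } } }.

Definition passes_through_exactly_two (l : line) (S : point_set) : Type :=
  ({ P : point & { Q : point & { PQ : distinct P Q &
     (S P * S Q * same_line l (mkLine P Q PQ))%type } } } *
   (contains_three l S -> False))%type.

Definition sylvester_gallai : Type :=
  forall S : point_set, finite S -> noncollinear S ->
  { l : line & passes_through_exactly_two l S }.

(* The lesser limited principle of omniscience, for real numbers. *)
Definition LLPO : Set := forall alpha : CReal, {alpha <= 0} + {0 <= alpha}.

Lemma CReal_sqr_nonneg (a : CReal) : 0 <= a * a.
Proof.
  intro H. assert (Ha : (a < 0) -> False).
  { intro Ha. apply (CRealLt_asym _ _ H).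
    setoid_replace (a * a) with ((- a) * (- a)) by ring.
    apply CReal_mult_lt_0_compat; apply CReal_neg_lt_pos; exact Ha. }
  apply (CReal_mult_le_0_compat a a Ha Ha H).
Qed.

Lemma CReal_le_of_sqr_le (a b : CReal) :
  0 <= b -> a * a <= b * b -> a <= b.
Proof.
  intros Hb H L. apply H.
  apply (CReal_le_lt_trans _ (b * a)).
  - apply CReal_mult_le_compat_l; [exact Hb|apply CRealLt_asym, L].
  - apply CReal_mult_lt_compat_r; [|exact L].
    apply (CReal_le_lt_trans _ b); assumption.
Qed.

Lemma dist_nonneg (P Q : point) : 0 <= dist P Q.
Proof. apply CReal_sqrt_nonneg. Qed.

Lemma dist_sqr (P Q : point) :
  dist P Q * dist P Q ==
  (px P - px Q) * (px P - px Q) + (py P - py Q) * (py P - py Q).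
Proof.
  apply CReal_sqrt_sqr.
  setoid_replace 0 with (0 + 0) by ring.
  apply CReal_plus_le_compat; apply CReal_sqr_nonneg.
Qed.

Lemma CReal_abs_sqr (a : CReal) : CReal_abs a * CReal_abs a == a * a.
Proof.
  rewrite <- CReal_abs_mult. apply CReal_abs_right, CReal_sqr_nonneg.
Qed.

Lemma line_dist_nonneg (P : point) (l : line) : 0 <= line_dist P l.
Proof.
  unfold line_dist. apply CReal_mult_le_0_compat; [apply CReal_abs_pos|].
  apply CRealLt_asym, CReal_inv_0_lt_compat, lQR.
Qed.

Lemma line_dist_mult (P : point) (l : line) :
  line_dist P l * dist (lQ l) (lR l) ==
  CReal_abs ((px (lR l) - px (lQ l)) * (py P - py (lQ l))
             - (py (lR l) - py (lQ l)) * (px P - px (lQ l))).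
Proof.
  unfold line_dist. rewrite CReal_mult_assoc, CReal_inv_l. ring.
Qed.

Lemma line_dist_le (P : point) (l : line) (t : CReal) :
  line_dist P l <= dist P (line_point l t).
Proof.
  set (D := dist (lQ l) (lR l)).
  apply (CReal_mult_le_reg_l D); [exact (lQR l)|].
  apply CReal_le_of_sqr_le.
  - apply CReal_mult_le_0_compat; apply dist_nonneg.
  - setoid_replace (D * line_dist P l * (D * line_dist P l))
      with ((line_dist P l * D) * (line_dist P l * D)) by ring.
    unfold D. rewrite line_dist_mult, CReal_abs_sqr. fold D.
    setoid_replace
      (D * dist P (line_point l t) * (D * dist P (line_point l t)))
      with ((D * D) * (dist P (line_point l t) * dist P (line_point l t)))
      by ring.
    unfold D. rewrite !dist_sqr. cbn [px py line_point].
    set (u := px (lR l)). set (v := py (lR l)).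
    set (x := px P). set (y := py P). set (p := px (lQ l)). set (q := py (lQ l)).
    set (w := (u - p) * (x - (p + t * (u - p)))
              + (v - q) * (y - (q + t * (v - q)))).
    apply (CReal_plus_le_reg_l
      (- (((u - p) * (y - q) - (v - q) * (x - p))
        * ((u - p) * (y - q) - (v - q) * (x - p))))).
    match goal with |- ?a <= ?b => setoid_replace a with 0 by ring;
      setoid_replace b with (w * w) by (unfold w; ring) end.
    apply CReal_sqr_nonneg.
Qed.

Lemma line_dist_attained (P : point) (l : line) :
  { t : CReal & dist P (line_point l t) == line_dist P l }.
Proof.
  set (D := dist (lQ l) (lR l)).
  set (i := CReal_inv D (inr (lQR l))).
  assert (Hi : i * D == 1) by (apply CReal_inv_l).
  set (c := (px (lR l) - px (lQ l)) * (px P - px (lQ l))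
            + (py (lR l) - py (lQ l)) * (py P - py (lQ l))).
  exists (c * (i * i)).
  split; [apply line_dist_le|].
  apply (CReal_mult_le_reg_l D); [exact (lQR l)|].
  apply CReal_le_of_sqr_le.
  - apply CReal_mult_le_0_compat; [apply dist_nonneg|apply line_dist_nonneg].
  - setoid_replace (D * line_dist P l * (D * line_dist P l))
      with ((line_dist P l * D) * (line_dist P l * D)) by ring.
    unfold D at 3 4. rewrite line_dist_mult, CReal_abs_sqr.
    set (e := dist P (line_point l (c * (i * i)))).
    setoid_replace (D * e * (D * e)) with (D * D * (e * e)) by ring.
    assert (HD : D * D * (i * i) == 1).
    { setoid_replace (D * D * (i * i)) with ((i * D) * (i * D)) by ring.
      rewrite Hi. ring. }
    unfold e. rewrite dist_sqr. unfold D in *. rewrite dist_sqr in HD |- *.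
    cbn [px py line_point]. unfold c.
    set (u := px (lR l)) in *. set (v := py (lR l)) in *.
    set (x := px P). set (y := py P).
    set (p := px (lQ l)) in *. set (q := py (lQ l)) in *.
    set (N := (p - u) * (p - u) + (q - v) * (q - v)) in *.
    set (k := (u - p) * (x - p) + (v - q) * (y - q)).
    assert (E : N * ((x - (p + k * (i * i) * (u - p))) * (x - (p + k * (i * i) * (u - p)))
              + (y - (q + k * (i * i) * (v - q))) * (y - (q + k * (i * i) * (v - q))))
            == ((u - p) * (y - q) - (v - q) * (x - p))
             * ((u - p) * (y - q) - (v - q) * (x - p))
             + (k * (1 - N * (i * i))) * (k * (1 - N * (i * i))))
      by (unfold k, N; ring).
    rewrite E, HD.
    match goal with |- ?a <= ?b => setoid_replace a with b by ring end.
    apply CRealLe_refl.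
Qed.

(* Main.v *)
(** To a triangle [A B C] add three points: [K] on the line [AB] and [M] on
    [BC], which move away from [A] and [C] exactly when [alpha > 0], and [L] on
    [AC], which moves away from [A] exactly when [alpha < 0].  If [alpha > 0],
    then [A, B, K, L] lie on one line and [B, C, M] on another, each containing
    three distinct points; if [alpha < 0], then all points but [B] lie on [AC],
    which contains three distinct points.  Any two of the six points lie
    together in one of these three groups, so whichever pair spans the line
    through exactly two points, one of the signs of [alpha] is refuted. *)

Require Import Defs.
From Stdlib Require Import ConstructiveCauchyReals ConstructiveCauchyRealsMult
  ConstructiveCauchyAbs.
From Stdlib Require Import Setoid Ring Lia.

Local Open Scope CReal_scope.

(** * Distinctness and incidence from coordinates *)

Lemma CReal_pos_of_sqr_pos (a : CReal) : 0 <= a -> 0 < a * a -> 0 < a.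
Proof.
  intros Ha H. destruct (CReal_mult_pos_appart_zero _ _ H) as [L|L].
  - exact L.
  - destruct (Ha L).
Qed.

Lemma CReal_lt_0_minus (a b : CReal) : a < b -> 0 < b - a.
Proof.
  intro H. apply (CReal_plus_lt_reg_r a). ring_simplify. exact H.
Qed.

Lemma CReal_minus_sqr_pos (a b : CReal) : a # b -> 0 < (a - b) * (a - b).
Proof.
  intros [L|L].
  - setoid_replace ((a - b) * (a - b)) with ((b - a) * (b - a)) by ring.
    apply CReal_mult_lt_0_compat; apply CReal_lt_0_minus, L.
  - apply CReal_mult_lt_0_compat; apply CReal_lt_0_minus, L.
Qed.

Lemma distinct_of_px (P Q : point) : px P # px Q -> distinct P Q.
Proof.
  intro H. apply CReal_pos_of_sqr_pos; [apply dist_nonneg|].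
  rewrite dist_sqr. apply (CReal_lt_le_trans _ _ _ (CReal_minus_sqr_pos _ _ H)).
  rewrite <- (CReal_plus_0_r (_ * _)) at 1.
  apply CReal_plus_le_compat; [apply CRealLe_refl|apply CReal_sqr_nonneg].
Qed.

Lemma distinct_of_py (P Q : point) : py P # py Q -> distinct P Q.
Proof.
  intro H. apply CReal_pos_of_sqr_pos; [apply dist_nonneg|].
  rewrite dist_sqr. apply (CReal_lt_le_trans _ _ _ (CReal_minus_sqr_pos _ _ H)).
  rewrite <- (CReal_plus_0_l (_ * _)) at 1.
  apply CReal_plus_le_compat; [apply CReal_sqr_nonneg|apply CRealLe_refl].
Qed.

(** Twice the signed area of the triangle [Q R P]: the numerator of [line_dist] before the absolute
    value is taken. *)
Definition det3 (P Q R : point) : CReal :=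
  (px R - px Q) * (py P - py Q) - (py R - py Q) * (px P - px Q).

Lemma lies_on_of_det3 (P : point) (l : line) :
  det3 P (lQ l) (lR l) == 0 -> lies_on P l.
Proof.
  intro H. unfold lies_on, line_dist, det3 in *. rewrite H.
  rewrite CReal_abs_right by apply CRealLe_refl. ring.
Qed.

Lemma lies_outside_of_det3 (P : point) (l : line) :
  0 < det3 P (lQ l) (lR l) -> lies_outside P l.
Proof.
  intro H. apply CReal_mult_lt_0_compat.
  - apply (CReal_lt_le_trans _ _ _ H), CReal_le_abs.
  - apply CReal_inv_0_lt_compat, lQR.
Qed.

(** [d] is a direction vector stored as a point. A line in this parametric form carries no proof of
    distinctness, and incidence is shown by giving [t]. *)
Definition aligned (O d P : point) : Prop :=
  exists t : CReal, point_eq P (mkPoint (px O + t * px d) (py O + t * py d)).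

Lemma aligned_point_eq (O d P Q : point) :
  point_eq P Q -> aligned O d Q -> aligned O d P.
Proof.
  intros [Hx Hy] [t [Htx Hty]]. exists t.
  split; [rewrite Hx; exact Htx|rewrite Hy; exact Hty].
Qed.

(** [lR l - lQ l] and [P - lQ l] are both multiples of [d], so their determinant vanishes. *)
Lemma aligned_lies_on (O d P : point) (l : line) :
  aligned O d (lQ l) -> aligned O d (lR l) -> aligned O d P -> lies_on P l.
Proof.
  intros [s [Hsx Hsy]] [t [Htx Hty]] [r [Hrx Hry]].
  apply lies_on_of_det3. unfold det3.
  rewrite Hsx, Hsy, Htx, Hty, Hrx, Hry. cbn [px py]. ring.
Qed.

(** * Listed sets and lines through an aligned triple *)

Definition listed (n : nat) (a : nat -> point) : point_set :=
  fun P => { i : nat & ((i < n)%nat * point_eq P (a i))%type }.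

Lemma finite_listed (n : nat) (a : nat -> point) :
  (1 <= n)%nat -> finite (listed n a).
Proof.
  intro Hn. exists n, a. split; [exact Hn|]. intro P. split; intro H; exact H.
Qed.

Lemma listed_nth (n : nat) (a : nat -> point) (i : nat) :
  (i < n)%nat -> listed n a (a i).
Proof.
  intro Hi. exists i. split; [exact Hi|split; reflexivity].
Qed.

Definition aligned_triple (S : point_set) (O d : point) : Type :=
  { A : point & { B : point & { C : point &
    (S A * S B * S C * aligned O d A * aligned O d B * aligned O d C *
     distinct A B * distinct A C * distinct B C)%type } } }.

(** Since [P] and [Q] are aligned along [d], the line they span contains every point aligned with
    them, the triple included. *)
Lemma contains_three_of_aligned (S : point_set) (O d P Q : point)
    (PQ : distinct P Q) (l : line) :
  same_line l (mkLine P Q PQ) -> aligned O d P -> aligned O d Q ->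
  aligned_triple S O d -> contains_three l S.
Proof.
  intros Hl HP HQ
    (A & B & C & ((((((((SA & SB) & SC) & HA) & HB) & HC) & AB) & AC) & BC)).
  assert (H : forall X, aligned O d X -> lies_on X l).
  { intros X HX. apply Hl.
    exact (aligned_lies_on O d X (mkLine P Q PQ) HP HQ HX). }
  exists A, B, C. repeat split; try assumption; apply H; assumption.
Qed.

(* [|alpha| + alpha] and [|alpha| - alpha] are twice the positive and negative
   parts of [alpha]. *)
Definition perturbed_triangle (alpha : CReal) (i : nat) : point :=
  let p := CReal_abs alpha + alpha in
  let n := CReal_abs alpha - alpha in
  match i with
  | 0%nat => mkPoint 0 0           (* A *)
  | 1%nat => mkPoint 1 0           (* B *)
  | 2%nat => mkPoint 0 1           (* C *)
  | 3%nat => mkPoint (- p) 0       (* K *)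
  | 4%nat => mkPoint 0 (- n)       (* L *)
  | _ => mkPoint (- p) (1 + p)     (* M *)
  end.

Definition perturbed_set (alpha : CReal) : point_set :=
  listed 6 (perturbed_triangle alpha).

Lemma perturbed_set_noncollinear (alpha : CReal) :
  noncollinear (perturbed_set alpha).
Proof.
  assert (AB : distinct (mkPoint 0 0) (mkPoint 1 0))
    by (apply distinct_of_px; left; apply CRealLt_0_1).
  assert (CA : distinct (mkPoint 0 1) (mkPoint 0 0))
    by (apply distinct_of_py; right; apply CRealLt_0_1).
  assert (CB : distinct (mkPoint 0 1) (mkPoint 1 0))
    by (apply distinct_of_py; right; apply CRealLt_0_1).
  (* The triangle [A B C] does not move with [alpha]. Taking [C] against the line from [A] to [B]
     gives the determinant the value [1], with the sign that [lies_outside_of_det3] asks for. *)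
  exists (mkPoint 0 1), (mkPoint 0 0), (mkPoint 1 0), AB.
  repeat split; try assumption.
  - exact (listed_nth 6 (perturbed_triangle alpha) 2 ltac:(lia)).
  - exact (listed_nth 6 (perturbed_triangle alpha) 0 ltac:(lia)).
  - exact (listed_nth 6 (perturbed_triangle alpha) 1 ltac:(lia)).
  - apply lies_outside_of_det3. unfold det3. cbn [px py lQ lR].
    setoid_replace ((1 - 0) * (1 - 0) - (0 - 0) * (0 - 0)) with 1 by ring.
    apply CRealLt_0_1.
Qed.

(** * Alignment among the six points and the sign of [alpha] *)

Lemma CReal_abs_plus_self_pos (alpha : CReal) :
  0 < alpha -> 0 < CReal_abs alpha + alpha.
Proof.
  intro H. rewrite CReal_abs_right by apply CRealLt_asym, H.
  setoid_replace 0 with (0 + 0) by ring.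
  apply CReal_plus_le_lt_compat; [apply CRealLt_asym|]; exact H.
Qed.

Lemma CReal_abs_minus_self_pos (alpha : CReal) :
  alpha < 0 -> 0 < CReal_abs alpha - alpha.
Proof.
  intro H. rewrite <- CReal_abs_opp.
  apply (CReal_abs_plus_self_pos (- alpha)), CReal_neg_lt_pos, H.
Qed.

(** [A], [B], [K] are on the first axis whatever [alpha] is; the sign makes them distinct, by
    [- p < 0 < 1] with [p] as in [perturbed_triangle]. *)
Lemma aligned_triple_AB (alpha : CReal) :
  0 < alpha ->
  aligned_triple (perturbed_set alpha) (mkPoint 0 0) (mkPoint 1 0).
Proof.
  intro H. pose proof (CReal_abs_plus_self_pos alpha H) as Hp.
  apply CReal_opp_gt_lt_contravar in Hp. rewrite CReal_opp_0 in Hp.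
  exists (perturbed_triangle alpha 0), (perturbed_triangle alpha 1),
    (perturbed_triangle alpha 3).
  repeat split; try (apply listed_nth; lia).
  - exists 0. split; cbn; ring.
  - exists 1. split; cbn; ring.
  - exists (- (CReal_abs alpha + alpha)). split; cbn; ring.
  - apply distinct_of_px. left. apply CRealLt_0_1.
  - apply distinct_of_px. right. exact Hp.
  - apply distinct_of_px. right. exact (CReal_lt_trans _ _ _ Hp CRealLt_0_1).
Qed.

(** The line is [x + y = 1], parametrised by the abscissa; [B], [C], [M] have parameters [1], [0],
    [- p]. *)
Lemma aligned_triple_BC (alpha : CReal) :
  0 < alpha ->
  aligned_triple (perturbed_set alpha) (mkPoint 0 1) (mkPoint 1 (- (1))).
Proof.
  intro H. pose proof (CReal_abs_plus_self_pos alpha H) as Hp.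
  apply CReal_opp_gt_lt_contravar in Hp. rewrite CReal_opp_0 in Hp.
  exists (perturbed_triangle alpha 1), (perturbed_triangle alpha 2),
    (perturbed_triangle alpha 5).
  repeat split; try (apply listed_nth; lia).
  - exists 1. split; cbn; ring.
  - exists 0. split; cbn; ring.
  - exists (- (CReal_abs alpha + alpha)). split; cbn; ring.
  - apply distinct_of_px. right. apply CRealLt_0_1.
  - apply distinct_of_px. right. exact (CReal_lt_trans _ _ _ Hp CRealLt_0_1).
  - apply distinct_of_px. right. exact Hp.
Qed.

Lemma aligned_triple_AC (alpha : CReal) :
  alpha < 0 ->
  aligned_triple (perturbed_set alpha) (mkPoint 0 0) (mkPoint 0 1).
Proof.
  intro H. pose proof (CReal_abs_minus_self_pos alpha H) as Hn.
  apply CReal_opp_gt_lt_contravar in Hn. rewrite CReal_opp_0 in Hn.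
  exists (perturbed_triangle alpha 0), (perturbed_triangle alpha 2),
    (perturbed_triangle alpha 4).
  repeat split; try (apply listed_nth; lia).
  - exists 0. split; cbn; ring.
  - exists 1. split; cbn; ring.
  - exists (- (CReal_abs alpha - alpha)). split; cbn; ring.
  - apply distinct_of_py. left. apply CRealLt_0_1.
  - apply distinct_of_py. right. exact Hn.
  - apply distinct_of_py. right. exact (CReal_lt_trans _ _ _ Hn CRealLt_0_1).
Qed.

(** For [alpha > 0] the negative part vanishes, so [L] falls onto [A]. *)
Lemma aligned_AB (alpha : CReal) (i : nat) :
  0 < alpha -> i <> 2%nat -> (i < 5)%nat ->
  aligned (mkPoint 0 0) (mkPoint 1 0) (perturbed_triangle alpha i).
Proof.
  intros H Hi2 Hi.
  assert (Hn : CReal_abs alpha - alpha == 0)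
    by (rewrite CReal_abs_right by apply CRealLt_asym, H; ring).
  exists (px (perturbed_triangle alpha i)).
  destruct i as [|[|[|[|[|i]]]]]; try lia; split; cbn; rewrite ?Hn; ring.
Qed.

Lemma aligned_BC (alpha : CReal) (i : nat) :
  i <> 0%nat -> i <> 3%nat -> i <> 4%nat ->
  aligned (mkPoint 0 1) (mkPoint 1 (- (1))) (perturbed_triangle alpha i).
Proof.
  intros Hi0 Hi3 Hi4. exists (px (perturbed_triangle alpha i)).
  (* Every index from [5] on is [M], by the default branch of [perturbed_triangle]. *)
  destruct i as [|[|[|[|[|i]]]]]; try lia; split; cbn; ring.
Qed.

(** For [alpha < 0] the positive part vanishes, so [K] falls onto [A] and [M] onto [C]. *)
Lemma aligned_AC (alpha : CReal) (i : nat) :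
  alpha < 0 -> i <> 1%nat ->
  aligned (mkPoint 0 0) (mkPoint 0 1) (perturbed_triangle alpha i).
Proof.
  intros H Hi.
  assert (Hp : CReal_abs alpha + alpha == 0)
    by (rewrite CReal_abs_left by apply CRealLt_asym, H; ring).
  exists (py (perturbed_triangle alpha i)).
  destruct i as [|[|[|[|[|i]]]]]; try lia; split; cbn; rewrite ?Hp; ring.
Qed.

(** The group is read off the indices, before any sign is known; being in [Set], it can select a
    side of [LLPO]. *)
Inductive pair_group (i j : nat) : Set :=
| group_AC : i <> 1%nat -> j <> 1%nat -> pair_group i j
| group_AB : i <> 2%nat -> (i < 5)%nat -> j <> 2%nat -> (j < 5)%nat ->
    pair_group i j
| group_BC : i <> 0%nat -> i <> 3%nat -> i <> 4%nat ->
    j <> 0%nat -> j <> 3%nat -> j <> 4%nat -> pair_group i j.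

(** A pair without [B] is in the group [AC]. Beside [B], the points [A], [K], [L] give [AB], and
    [C], [M] give [BC]. *)
Lemma pair_group_total (i j : nat) : (i < 6)%nat -> (j < 6)%nat -> pair_group i j.
Proof.
  intros Hi Hj.
  destruct i as [|[|[|[|[|[|i]]]]]]; try (exfalso; lia);
  destruct j as [|[|[|[|[|[|j]]]]]]; try (exfalso; lia);
  first [ apply group_AC; lia | apply group_AB; lia | apply group_BC; lia ].
Qed.

Theorem mainTheorem1 : sylvester_gallai -> LLPO.
Proof.
  intros SG alpha.
  destruct (SG (perturbed_set alpha) (finite_listed 6 _ ltac:(lia))
              (perturbed_set_noncollinear alpha))
    as [l [(P & Q & PQ & [[[i [Hi HP]] [j [Hj HQ]]] Hl]) Hno]].
  destruct (pair_group_total i j Hi Hj)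
    as [Hi1 Hj1|Hi2 Hi5 Hj2 Hj5|Hi0 Hi3 Hi4 Hj0 Hj3 Hj4];
    (* Each side of [LLPO] refutes a strict inequality, so that inequality may be assumed as [H]; it
       puts three distinct points on [l]. *)
    [right|left|left]; intro H; apply Hno.
  - apply (contains_three_of_aligned _ _ _ _ _ _ _ Hl
      (aligned_point_eq _ _ _ _ HP (aligned_AC _ _ H Hi1))
      (aligned_point_eq _ _ _ _ HQ (aligned_AC _ _ H Hj1))
      (aligned_triple_AC _ H)).
  - apply (contains_three_of_aligned _ _ _ _ _ _ _ Hl
      (aligned_point_eq _ _ _ _ HP (aligned_AB _ _ H Hi2 Hi5))
      (aligned_point_eq _ _ _ _ HQ (aligned_AB _ _ H Hj2 Hj5))
      (aligned_triple_AB _ H)).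
  - apply (contains_three_of_aligned _ _ _ _ _ _ _ Hl
      (aligned_point_eq _ _ _ _ HP (aligned_BC _ _ Hi0 Hi3 Hi4))
      (aligned_point_eq _ _ _ _ HQ (aligned_BC _ _ Hj0 Hj3 Hj4))
      (aligned_triple_BC _ H)).
Qed.
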